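(* For every integer $d\ge 1$ there exists a constant $C_d>0$ such that for all $n\ge 1$ and all $A=\sum_{\mathbf{s}\in\{0,1,2,3\}^n,\ |\mathbf{s}|\le d}\widehat{A}_{\mathbf{s}}\,\sigma_{\mathbf{s}}\in M_2(\mathbb{C})^{\otimes n}$ of degree at most $d$, \[ \Big(\sum_{|\mathbf{s}|\le d}|\widehat{A}_{\mathbf{s}}|^{\frac{2d}{d+1}}\Big)^{\frac{d+1}{2d}}\le C_d\,\|A\|, \] where $\|A\|$ is the operator norm. Moreover, one can take $C_d\le 3^d\,\mathrm{BH}^{\le d}_{\{\pm1\}}$.
   Context: Pauli matrices: $\sigma_0=I_2$, $\sigma_1=\begin{pmatrix}0&1\\1&0\end{pmatrix}$, $\sigma_2=\begin{pmatrix}0&-i\\ i&0\end{pmatrix}$, $\sigma_3=\begin{pmatrix}1&0\\0&-1\end{pmatrix}$. For $\mathbf{s}=(s_1,\dots,s_n)\in\{0,1,2,3\}^n$, $\sigma_{\mathbf{s}}=\sigma_{s_1}\otimes\cdots\otimes\sigma_{s_n}$; these form a basis of $M_2(\mathbb{C})^{\otimes n}$, so every $A$ has a unique expansion $A=\sum_{\mathbf{s}}\widehat{A}_{\mathbf{s}}\sigma_{\mathbf{s}}$. $|\mathbf{s}|$ denotes the number of nonzero entries of $\mathbf{s}$; $A$ is of degree $d$ if $\widehat{A}_{\mathbf{s}}=0$ whenever $|\mathbf{s}|>d$. For a function $f:\{-1,1\}^m\to\mathbb{C}$ write $f=\sum_{S\subset[m]}\widehat f(S)\chi_S$ with $\chi_S(x)=\prod_{j\in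 S}x_j$; $f$ has degree $d$ if $\widehat f(S)=0$ for $|S|>d$. $\mathrm{BH}^{\le d}_{\{\pm1\}}$ denotes the best constant $C$ such that for all $m\ge1$ and all $f:\{-1,1\}^m\to\mathbb{C}$ of degree $d$, $\big(\sum_{|S|\le d}|\widehat f(S)|^{\frac{2d}{d+1}}\big)^{\frac{d+1}{2d}}\le C\|f\|_\infty$ (this constant is known to be finite, indeed at most $C^{\sqrt{d\log d}}$ for an absolute $C$, by Defant–Mastyło–Pérez). *)

(* Defs.v *)
From HB Require Import structures.
From mathcomp Require Import all_boot all_order all_algebra.
From mathcomp Require Import complex.
From mathcomp Require Import all_classical all_reals.
From mathcomp Require Import exp.

Set Implicit Arguments.
Unset Strict Implicit.
Unset Printing Implicit Defensive.

Import Order.TTheory GRing.Theory Num.Theory.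
Local Open Scope ring_scope.
Local Open Scope classical_set_scope.

Section Defs.
Variable R : realType.
Local Notation C := (R[i]).

Definition cabs (z : C) : R := Normc.normc z.

Definition pauli1 (k : 'I_4) (a b : 'I_2) : C :=
  match val k with
  | 0%N => if a == b then 1 else 0
  | 1%N => if a != b then 1 else 0
  | 2%N => if a == b then 0
           else if val a == 0%N then - 'i%C else 'i%C
  | _ => if a == b then (if val a == 0%N then 1 else -1) else 0
  end.

(* Computational basis of (C^2)^{\otimes n}: bit strings 'I_n -> 'I_2.
   An operator on (C^2)^{\otimes n} is given by its matrix in this basis,
   i.e. a function basis -> basis -> C. *)
Definition qbasis (n : nat) := {ffun 'I_n -> 'I_2}.
Definition qop (n : nat) := qbasis n -> qbasis n -> C.

(* Pauli strings sigma_s = sigma_{s_1} (x) ... (x) sigma_{s_n}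
   (entries of the Kronecker product) *)
Definition pauli (n : nat) (s : {ffun 'I_n -> 'I_4}) : qop n :=
  fun x y => \prod_(j < n) pauli1 (s j) (x j) (y j).

Definition pweight (n : nat) (s : {ffun 'I_n -> 'I_4}) : nat :=
  #|[set j | s j != ord0]|.

Definition pauli_sum (n : nat) (Ahat : {ffun 'I_n -> 'I_4} -> C) : qop n :=
  fun x y => \sum_(s : {ffun 'I_n -> 'I_4}) Ahat s * pauli s x y.

Definition vnorm (n : nat) (v : qbasis n -> C) : R :=
  Num.sqrt (\sum_(x : qbasis n) cabs (v x) ^+ 2).

Definition opapply (n : nat) (A : qop n) (v : qbasis n -> C) : qbasis n -> C :=
  fun x => \sum_(y : qbasis n) A x y * v y.

Definition opnorm (n : nat) (A : qop n) : R :=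
  sup [set vnorm (opapply A v) | v in [set v : qbasis n -> C | vnorm v <= 1]].

Definition bh_lhs (d : nat) (I : finType) (P : pred I) (c : I -> C) : R :=
  (\sum_(i | P i) cabs (c i) `^ ((2 * d)%:R / (d.+1)%:R)) `^ ((d.+1)%:R / (2 * d)%:R).

(* Boolean cube {-1,1}^m, encoded by bool (true <-> -1) *)
Definition chi (m : nat) (S : {set 'I_m}) (x : {ffun 'I_m -> bool}) : C :=
  \prod_(j in S) (if x j then -1 else 1).

Definition bfun (m : nat) (fhat : {set 'I_m} -> C) (x : {ffun 'I_m -> bool}) : C :=
  \sum_(S : {set 'I_m}) fhat S * chi S x.

Definition supnorm (m : nat) (f : {ffun 'I_m -> bool} -> C) : R :=
  \big[Num.max/0]_(x : {ffun 'I_m -> bool}) cabs (f x).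

Definition BH_admissible (d : nat) (K : R) : Prop :=
  forall (m : nat), (1 <= m)%N ->
  forall fhat : {set 'I_m} -> C,
    (forall S : {set 'I_m}, (d < #|S|)%N -> fhat S = 0) ->
    bh_lhs d (fun S : {set 'I_m} => (#|S| <= d)%N) fhat
      <= K * supnorm (bfun fhat).

Definition BH (d : nat) : R := inf [set K | BH_admissible d K].

End Defs.

(* Main.v *)
(* Quantum to Boolean.  Give every site j signs x_(j,1), x_(j,2), x_(j,3), and
   let k range over {1,2,3}^n.  If v_(k,x) is the product of the unit
   eigenvectors of sigma_(k_j) for the eigenvalues x_(j,k_j), then
   <v_(k,x), sigma_s v_(k,x)> is the product of the x_(j,s_j) over the support of
   s if s and k agree there, and 0 otherwise.  Averaging <v, A v> over k gives a
   function on the cube, bounded by the operator norm of A, whose Walsh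
   coefficients are 3^(-|s|) A^_s; the Boolean inequality applied to it loses 3^d.

   Finiteness of BH.  Let f be a real function of degree at most d on the cube,
   |f| <= 1, with coefficients c_S, and s_j^2 = sum_(S containing j) c_S^2.
   Hypercontractivity (L^2 <= 3^d L^1) and a Bernstein inequality at 0 along the
   lines t -> F(x/2 + t b) of the multiaffine extension F bound sum_j s_j by a
   constant depending only on d.  If j minimises s_j over a nonempty S, then
   |c_S|^(2d/(d+1)) <= c_S^2 / s_j + s_j^d, and s_j^d <= prod_(i in S) s_i since
   s_i <= 1.  Summing over S bounds the left-hand side by
   sum_j s_j + prod_j (1 + s_j). *)
Require Import Defs.
From HB Require Import structures.
From mathcomp Require Import all_boot all_order all_algebra.
From mathcomp Require Import complex ring lra.
From mathcomp Require Import all_classical all_reals.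
From mathcomp Require Import sequences exp finset.

Set Implicit Arguments.
Unset Strict Implicit.

Import Order.TTheory GRing.Theory Num.Theory.
Local Open Scope ring_scope.

(** * Walsh polynomials and hypercontractivity *)

(** Cauchy-Schwarz: the sum of the squares of [B * f i - A * g i] equals [A * (A * C - B ^+ 2)], and
    [A = 0] forces [f] to vanish. *)
Lemma sqr_sum_le (R : realFieldType) (I : finType) (f g : I -> R) :
  (\sum_i f i * g i) ^+ 2 <= (\sum_i f i ^+ 2) * (\sum_i g i ^+ 2).
Proof.
have sqE a b : \sum_i (b * f i - a * g i) ^+ 2
    = b ^+ 2 * (\sum_i f i ^+ 2) + (- (2 * a * b)) * (\sum_i f i * g i)
      + a ^+ 2 * (\sum_i g i ^+ 2).
  by rewrite !mulr_sumr -!big_split /=; apply: eq_bigr => i _; ring.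
set A := \sum_i f i ^+ 2 in sqE *; set B := \sum_i f i * g i in sqE *.
set C := \sum_i g i ^+ 2 in sqE *.
have A0 : 0 <= A by apply: sumr_ge0 => i _; exact: sqr_ge0.
have [A00|An0] := eqVneq A 0.
  suff -> : B = 0 by rewrite A00 expr0n mul0r.
  apply: big1 => i _; suff -> : f i = 0 by rewrite mul0r.
  apply/eqP; rewrite -sqrf_eq0.
  by rewrite (psumr_eq0P _ A00) // => k _; exact: sqr_ge0.
have : 0 <= \sum_i (B * f i - A * g i) ^+ 2.
  by apply: sumr_ge0 => i _; exact: sqr_ge0.
rewrite sqE.
have -> : B ^+ 2 * A + (- (2 * A * B)) * B + A ^+ 2 * C = A * (A * C - B ^+ 2) by ring.
by rewrite pmulr_rge0 ?lt_neqAle 1?eq_sym ?An0 ?A0 // subr_ge0.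
Qed.

Lemma big_setU1_in (R : nmodType) (I : finType) (j : I) (G : {set I} -> R) :
  \sum_(S : {set I} | j \in S) G S = \sum_(S : {set I} | j \notin S) G (j |: S).
Proof.
rewrite (reindex_onto (fun S => j |: S) (fun S => S :\ j)) /=; last first.
  by move=> S; exact: setD1K.
apply: eq_bigl => S; rewrite setU11 /=.
apply/eqP/idP => [<-|jS]; first by rewrite setD11.
by rewrite setU1K.
Qed.

Section CubeMean.
Variables (R : realFieldType) (I : finType).
Local Notation cube := {ffun I -> bool}.

Definition mean (F : cube -> R) : R := (2 ^+ #|I|)^-1 * \sum_x F x.

Definition flip (j : I) (x : cube) : cube :=
  [ffun i => if i == j then ~~ x i else x i].

Lemma flipK j : involutive (flip j).
Proof. by move=> x; apply/ffunP => i; rewrite !ffunE; case: eqP; rewrite ?negbK. Qed.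

Lemma mean_flip j F : mean (fun x => F (flip j x)) = mean F.
Proof.
congr (_ * _); rewrite [RHS](reindex (flip j)) //.
exact/onW_bij/inv_bij/flipK.
Qed.

Lemma meanD F G : mean (fun x => F x + G x) = mean F + mean G.
Proof. by rewrite /mean big_split mulrDr. Qed.

Lemma meanZ a F : mean (fun x => a * F x) = a * mean F.
Proof. by rewrite /mean -mulr_sumr mulrCA. Qed.

Lemma mean_sum (J : finType) (F : J -> cube -> R) :
  mean (fun x => \sum_j F j x) = \sum_j mean (F j).
Proof. by rewrite /mean exchange_big mulr_sumr. Qed.

Lemma ler_mean F G : (forall x, F x <= G x) -> mean F <= mean G.
Proof.
by move=> FG; rewrite ler_wpM2l ?invr_ge0 ?exprn_ge0 //; apply: ler_sum.
Qed.

Lemma mean_cst a : mean (fun=> a) = a.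
Proof.
rewrite /mean sumr_const card_ffun card_bool -[a *+ _]mulr_natr natrX mulrCA mulVf ?mulr1 //.
by rewrite expf_neq0 // pnatr_eq0.
Qed.

Lemma mean_ge0 F : (forall x, 0 <= F x) -> 0 <= mean F.
Proof. by move=> F0; rewrite -[leLHS](mean_cst 0); apply: ler_mean. Qed.

Lemma eq_mean F G : F =1 G -> mean F = mean G.
Proof. by move=> FG; congr (_ * _); apply: eq_bigr. Qed.

Lemma mean_sqr_le F G :
  mean (fun x => F x * G x) ^+ 2
    <= mean (fun x => F x ^+ 2) * mean (fun x => G x ^+ 2).
Proof.
rewrite /mean; set K := (_ ^+ #|I|)^-1.
rewrite exprMn [leRHS](mulrACA K) -expr2.
by apply: ler_wpM2l; [exact: sqr_ge0 | exact: sqr_sum_le].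
Qed.

End CubeMean.

Section Multiaffine.
Variables (R : realFieldType) (I : finType).
Local Notation cube := {ffun I -> bool}.
Implicit Types (c : {set I} -> R) (x : cube) (y : I -> R).

Definition maff c y : R := \sum_(S : {set I}) c S * \prod_(j in S) y j.

Definition sgn x : I -> R := fun j => (-1) ^+ x j.

(* Coefficients of the restriction of [maff c] to [y j = 0] and of its partial
   derivative in [y j]. *)
Definition cdel c j : {set I} -> R := fun S => if j \in S then 0 else c S.

Definition cder c j : {set I} -> R := fun S => if j \in S then 0 else c (j |: S).

(** Each coefficient of [c] appears once in [cdel c j] or [cder c j]; [G 0 = 0] discards their zero
    padding. *)
Lemma sum_cdel_cder (G : R -> R) c j : G 0 = 0 ->
  \sum_S G (c S) = \sum_S G (cdel c j S) + \sum_S G (cder c j S).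
Proof.
move=> G0; rewrite (bigID (fun S : {set I} => j \in S)) /= addrC big_setU1_in.
congr (_ + _); rewrite [RHS](bigID (fun S : {set I} => j \in S)) /= [X in _ = X + _]big1 ?add0r.
- by apply: eq_bigr => S /negPf jS; rewrite /cdel jS.
- by move=> S jS; rewrite /cdel jS.
- by apply: eq_bigr => S /negPf jS; rewrite /cder jS.
- by move=> S jS; rewrite /cder jS.
Qed.

Lemma maff_split c j y : maff c y = maff (cdel c j) y + y j * maff (cder c j) y.
Proof.
rewrite {1}/maff (bigID (fun S : {set I} => j \in S)) /= addrC big_setU1_in.
congr (_ + _).
  rewrite /maff [RHS](bigID (fun S : {set I} => j \in S)) /= [X in _ = X + _]big1 ?add0r.
    by apply: eq_bigr => S /negPf jS; rewrite /cdel jS.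
  by move=> S jS; rewrite /cdel jS mul0r.
rewrite /maff [X in _ * X](bigID (fun S : {set I} => j \in S)) /= [X in _ * (X + _)]big1 ?add0r.
  rewrite mulr_sumr; apply: eq_bigr => S jS.
  by rewrite /cder (negPf jS) big_setU1 //= mulrCA.
by move=> S jS; rewrite /cder jS mul0r.
Qed.

Lemma maff_flip c j x : (forall S : {set I}, j \in S -> c S = 0) ->
  maff c (sgn (flip j x)) = maff c (sgn x).
Proof.
move=> cj; apply: eq_bigr => S _.
have [jS|jS] := boolP (j \in S); first by rewrite cj // !mul0r.
congr (_ * _); apply: eq_bigr => i iS; rewrite /sgn ffunE.
by case: eqP iS jS => // -> ->.
Qed.

Lemma sgn_flip j x : sgn (flip j x) j = - sgn x j.
Proof. by rewrite /sgn ffunE eqxx; case: (x j); rewrite /= ?expr1 ?expr0 ?opprK. Qed.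

Lemma sgn_sqr x j : sgn x j ^+ 2 = 1.
Proof. by rewrite /sgn; case: (x j); rewrite /= ?expr1 ?expr0 ?sqrrN expr1n. Qed.

Lemma mean_half_flip j (F : cube -> R) :
  mean F = mean (fun x => (F x + F (flip j x)) / 2).
Proof.
rewrite -[RHS](eq_mean (F := fun x => 2^-1 * (F x + F (flip j x)))).
  by rewrite meanZ meanD mean_flip; field.
by move=> x; rewrite mulrC.
Qed.

Lemma maff_cst c y : (forall S, S != set0 -> c S = 0) -> maff c y = c set0.
Proof.
move=> c0; rewrite /maff (bigD1 set0) //= big_set0 mulr1 big1 ?addr0 //.
by move=> S S0; rewrite c0 ?mul0r.
Qed.

Lemma sum_sqr_cst c : (forall S, S != set0 -> c S = 0) ->
  \sum_S c S ^+ 2 = c set0 ^+ 2.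
Proof.
move=> c0; rewrite (bigD1 set0) //= big1 ?addr0 //.
by move=> S S0; rewrite c0 // expr0n.
Qed.

(** Write the polynomial as a + x_j b with a and b free of x_j: averaging over the flip of x_j
    cancels the odd powers of x_j, here the cross term. *)
Lemma mean_sqr_split c j :
  mean (fun x => maff c (sgn x) ^+ 2)
  = mean (fun x => maff (cdel c j) (sgn x) ^+ 2)
    + mean (fun x => maff (cder c j) (sgn x) ^+ 2).
Proof.
rewrite (mean_half_flip j) -meanD; apply: eq_mean => x.
rewrite !(maff_split c j) !maff_flip ?sgn_flip; try by move=> S jS; rewrite /cdel /cder jS.
have := sgn_sqr x j; set a := maff _ _; set b := maff _ _ => e.
transitivity (a ^+ 2 + sgn x j ^+ 2 * b ^+ 2); first by field.
by rewrite e mul1r.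
Qed.

Lemma mean_pow4_split c j :
  mean (fun x => maff c (sgn x) ^+ 4)
  = mean (fun x => maff (cdel c j) (sgn x) ^+ 4)
    + 6 * mean (fun x => maff (cdel c j) (sgn x) ^+ 2 * maff (cder c j) (sgn x) ^+ 2)
    + mean (fun x => maff (cder c j) (sgn x) ^+ 4).
Proof.
rewrite (mean_half_flip j) -meanZ -!meanD; apply: eq_mean => x.
rewrite !(maff_split c j) !maff_flip ?sgn_flip; try by move=> S jS; rewrite /cdel /cder jS.
have := sgn_sqr x j; set a := maff _ _; set b := maff _ _ => e.
transitivity (a ^+ 4 + 6 * (sgn x j ^+ 2 * (a ^+ 2 * b ^+ 2)) + (sgn x j ^+ 2) ^+ 2 * b ^+ 4).
  by field.
by rewrite e expr1n !mul1r.
Qed.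

Lemma parseval c : mean (fun x => maff c (sgn x) ^+ 2) = \sum_S c S ^+ 2.
Proof.
(* Induction on the number of variables that actually occur: [V] shrinks while the index type [I]
   stays fixed. *)
suff H n (V : {set I}) c' : #|V| = n -> (forall S : {set I}, ~~ (S \subset V) -> c' S = 0) ->
    mean (fun x => maff c' (sgn x) ^+ 2) = \sum_S c' S ^+ 2.
  by apply: (H _ setT) => // S; rewrite subsetT.
elim: n V c' => [|n IHn] V c' Vn cV.
  have {}cV S : S != set0 -> c' S = 0.
    by move=> S0; apply: cV; rewrite (cards0_eq Vn) subset0.
  rewrite sum_sqr_cst // -[RHS](@mean_cst R I); apply: eq_mean => x.
  by rewrite maff_cst.
have /card_gt0P[j jV] : (0 < #|V|)%N by rewrite Vn.
have VDn : #|V :\ j| = n by move: Vn; rewrite (cardsD1 j V) jV => -[].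
rewrite (mean_sqr_split _ j) (sum_cdel_cder (G := fun a : R => a ^+ 2) _ j) ?expr0n //.
congr (_ + _); apply: (IHn (V :\ j)) => // S.
  rewrite /cdel; case: ifPn => // jS nS; apply: cV; apply: contra nS => SV.
  by rewrite subsetD1 SV.
rewrite /cder; case: ifPn => // jS nS; apply: cV; apply: contra nS.
by rewrite subUset subsetD1 jS andbT => /andP[].
Qed.

(** Induction on the variables, with f = a + x_j b, where b has degree one less. The mean of f^4 is
    that of a^4 + 6 a^2 b^2 + b^4; Cauchy-Schwarz bounds the middle mean by 3 * 9^(d-1) A B, with A
    and B the squared L^2 norms of a and b. The total is at most 9^d (A + B)^2. *)
Lemma bonami d c : (forall S : {set I}, (d < #|S|)%N -> c S = 0) ->
  mean (fun x => maff c (sgn x) ^+ 4) <= 9 ^+ d * (\sum_S c S ^+ 2) ^+ 2.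
Proof.
suff H n (V : {set I}) d' c' : #|V| = n ->
    (forall S : {set I}, ~~ (S \subset V) -> c' S = 0) ->
    (forall S : {set I}, (d' < #|S|)%N -> c' S = 0) ->
    mean (fun x => maff c' (sgn x) ^+ 4) <= 9 ^+ d' * (\sum_S c' S ^+ 2) ^+ 2.
  by apply: (H _ setT) => // S; rewrite subsetT.
have Hcst d1 c1 : (forall S, S != set0 -> c1 S = 0) ->
    mean (fun x => maff c1 (sgn x) ^+ 4) <= 9 ^+ d1 * (\sum_S c1 S ^+ 2) ^+ 2.
  move=> c10; rewrite sum_sqr_cst // -exprM.
  rewrite (@eq_mean _ _ _ (fun=> c1 set0 ^+ 4)); last by move=> x; rewrite maff_cst.
  rewrite mean_cst ler_peMl ?exprn_ege1 //; last by rewrite (ler_nat _ 1 9).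
  by rewrite (exprM _ 2 2) sqr_ge0.
elim: n V d' c' => [|n IHn] V d' c' Vn cV cd.
  by apply: Hcst => S S0; apply: cV; rewrite (cards0_eq Vn) subset0.
case: d' cd => [|d'] cd.
  by apply: Hcst => S S0; apply: cd; rewrite lt0n cards_eq0.
have /card_gt0P[j jV] : (0 < #|V|)%N by rewrite Vn.
have VDn : #|V :\ j| = n by move: Vn; rewrite (cardsD1 j V) jV => -[].
have Ha := IHn (V :\ j) d'.+1 (cdel c' j) VDn.
have Hb := IHn (V :\ j) d' (cder c' j) VDn.
rewrite (mean_pow4_split _ j) (sum_cdel_cder (G := fun a : R => a ^+ 2) _ j) ?expr0n //.
set A := \sum_S cdel c' j S ^+ 2 in Ha *.
set B := \sum_S cder c' j S ^+ 2 in Hb *.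
have A0 : 0 <= A by apply: sumr_ge0 => S _; exact: sqr_ge0.
have B0 : 0 <= B by apply: sumr_ge0 => S _; exact: sqr_ge0.
have {}Ha : mean (fun x => maff (cdel c' j) (sgn x) ^+ 4) <= 9 ^+ d'.+1 * A ^+ 2.
  apply: Ha => S.
    rewrite /cdel; case: ifPn => // jS nS; apply: cV; apply: contra nS => SV.
    by rewrite subsetD1 SV.
  by rewrite /cdel; case: ifPn => // jS; exact: cd.
have {}Hb : mean (fun x => maff (cder c' j) (sgn x) ^+ 4) <= 9 ^+ d' * B ^+ 2.
  apply: Hb => S.
    rewrite /cder; case: ifPn => // jS nS; apply: cV; apply: contra nS.
    by rewrite subUset subsetD1 jS andbT => /andP[].
  by rewrite /cder; case: ifPn => // jS Sd; apply: cd; rewrite cardsU1 jS.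
have := mean_sqr_le (fun x => maff (cdel c' j) (sgn x) ^+ 2)
                    (fun x => maff (cder c' j) (sgn x) ^+ 2).
have e4 c1 : mean (fun x => (maff c1 (sgn x) ^+ 2) ^+ 2)
    = mean (fun x => maff c1 (sgn x) ^+ 4).
  by apply: eq_mean => x; rewrite -exprM.
rewrite !e4; set M := mean (fun x => _ * _) => HM.
have M0 : 0 <= M by apply: mean_ge0 => x; rewrite mulr_ge0 ?sqr_ge0.
clearbody M.
have P0 : 0 <= 9 ^+ d' :> R by rewrite exprn_ge0.
have {}HM : M <= 3 * 9 ^+ d' * (A * B).
  rewrite -(@ler_pXn2r _ 2) ?nnegrE ?mulr_ge0 //.
  apply: (le_trans HM); apply: (le_trans (ler_pM _ _ Ha Hb)).
  - by apply: mean_ge0 => x; rewrite (exprM _ 2 2) sqr_ge0.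
  - by apply: mean_ge0 => x; rewrite (exprM _ 2 2) sqr_ge0.
  by rewrite exprS le_eqVlt; apply/orP; left; apply/eqP; ring.
move: Ha Hb HM P0; rewrite (exprS 9 d'); move: (9 ^+ d') => P Ha Hb HM P0.
have PB0 : 0 <= P * B ^+ 2 by rewrite mulr_ge0 ?sqr_ge0.
have -> : 9 * P * (A + B) ^+ 2
    = 9 * P * A ^+ 2 + 6 * (3 * P * (A * B)) + P * B ^+ 2 + 8 * (P * B ^+ 2) by ring.
rewrite -[leLHS]addr0 !lerD ?mulr_ge0 //.
by rewrite ler_wpM2l.
Qed.

(** L^2 is interpolated between L^1 and L^4: [V ^+ 3 <= M ^+ 2 * Q], while [bonami] gives
    [Q <= 9 ^+ d * V ^+ 2], and [V ^+ 2] cancels. *)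
Lemma l2_le_l1 d c : (forall S : {set I}, (d < #|S|)%N -> c S = 0) ->
  \sum_S c S ^+ 2 <= 9 ^+ d * mean (fun x => `|maff c (sgn x)|) ^+ 2.
Proof.
move=> cd; have HB := bonami cd; have HP := parseval c.
set V := \sum_S _ in HB HP *; set M := mean _; set Q := mean _ in HB.
have V0 : 0 <= V by apply: sumr_ge0 => S _; exact: sqr_ge0.
have M0 : 0 <= M by apply: mean_ge0 => x; exact: normr_ge0.
have Q0 : 0 <= Q by apply: mean_ge0 => x; rewrite (exprM _ 2 2) sqr_ge0.
have [->|Vn0] := eqVneq V 0; first by rewrite mulr_ge0 ?exprn_ge0.
have [M00|Mn0] := eqVneq M 0.
  suff /eqP V00 : V == 0 by rewrite V00 eqxx in Vn0.
  rewrite -HP /mean big1 ?mulr0 // => x _.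
  move/eqP: M00; rewrite /M /mean mulf_eq0 invr_eq0 expf_eq0 pnatr_eq0 andbF /=.
  rewrite psumr_eq0 => [/allP/(_ x)|y _]; last exact: normr_ge0.
  by rewrite mem_index_enum normr_eq0 => /(_ isT)/eqP ->; rewrite expr0n.
have Mp : 0 < M by rewrite lt_neqAle eq_sym Mn0.
(* Holder's inequality V^3 <= M^2 Q, from the pointwise inequality
   0 <= h (M h - V)^2 (M h + 2 V). *)
have HQ : V ^+ 3 <= M ^+ 2 * Q.
  rewrite -subr_ge0 -(pmulr_rge0 _ Mp).
  have -> : M * (M ^+ 2 * Q - V ^+ 3) = M ^+ 3 * Q
      + (- (3 * V ^+ 2 * M)) * mean (fun x => maff c (sgn x) ^+ 2) + 2 * V ^+ 3 * M.
    by rewrite HP; ring.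
  rewrite -(meanZ (M ^+ 3)) -(meanZ (- _)) -(meanZ (2 * V ^+ 3)) -!meanD.
  apply: mean_ge0 => x; set h := maff c (sgn x).
  have -> : M ^+ 3 * h ^+ 4 + (- (3 * V ^+ 2 * M)) * h ^+ 2 + 2 * V ^+ 3 * `|h|
      = `|h| * ((M * `|h| - V) ^+ 2 * (M * `|h| + 2 * V)).
    have e : h ^+ 2 = `|h| ^+ 2 by rewrite real_normK ?num_real.
    by rewrite (exprM _ 2 2) e; ring.
  apply: mulr_ge0; first exact: normr_ge0.
  apply: mulr_ge0; first exact: sqr_ge0.
  by apply: addr_ge0; apply: mulr_ge0 => //; exact: normr_ge0.
have Vp : 0 < V by rewrite lt_neqAle eq_sym Vn0.
rewrite -(ler_pM2r (exprn_gt0 2 Vp)).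
apply: (le_trans _ (le_trans HQ _)); first by rewrite -exprS.
rewrite [leRHS]mulrAC [leRHS]mulrC.
by apply: ler_wpM2l => //; exact: sqr_ge0.
Qed.

End Multiaffine.

(** * Bernstein inequality at the origin *)

(** Induction on the degree, with no attempt at a sharp constant. The combination below removes the
    top coefficient, is bounded by (D + 1) M, and multiplies the linear coefficient by D/2 - 1,
    which is at least 1. In degree one, q(1) - q(-1) is twice the linear coefficient. *)
Lemma coef1_bound (R : realFieldType) (d : nat) : exists2 K : R, 0 <= K &
  forall (q : {poly R}) (M : R), (size q <= d.+1)%N ->
    (forall t, `|t| <= 1 -> `|q.[t]| <= M) -> `|q`_1| <= K * M.
Proof.
elim: d => [|d [K K0 IH]].
  by exists 0 => // q M sq _; rewrite nth_default // normr0 mul0r.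
case: d IH => [|d] IH.
  exists 1 => // q M sq qM.
  have qE t : q.[t] = q`_0 + q`_1 * t.
    by rewrite (horner_coef_wide _ sq) !big_ord_recl big_ord0 /= expr0 expr1 mulr1 addr0.
  have := ler_normB q.[1] q.[-1]; rewrite !qE.
  have -> : q`_0 + q`_1 * 1 - (q`_0 + q`_1 * -1) = 2 * q`_1 by ring.
  rewrite -!qE normrM ger0_norm // => H.
  have := qM 1; have := qM (-1); rewrite normrN normr1 => /(_ (lexx _)) H1 /(_ (lexx _)) H2.
  by rewrite mul1r; lra.
pose D : R := 2 ^+ d.+2.
have D0 : 0 <= D by rewrite exprn_ge0.
exists (K * (D + 1)) => [|q M sq qM].
  by apply: mulr_ge0 => //; apply: addr_ge0.
(* p(t) = D q(t/2) - q(t) has no term of degree d + 2. *)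
pose p : {poly R} := \poly_(i < d.+2) ((D * 2^-1 ^+ i - 1) * q`_i).
have pE t : p.[t] = D * q.[2^-1 * t] - q.[t].
  rewrite horner_poly !(horner_coef_wide _ sq) mulr_sumr -sumrB.
  rewrite [RHS]big_ord_recr /= [X in _ + X](_ : _ = 0) ?addr0.
    by apply: eq_bigr => i _; rewrite exprMn; ring.
  have : D * 2^-1 ^+ d.+2 = 1 by rewrite -exprMn divff ?pnatr_eq0 // expr1n.
  rewrite exprMn; move: (_ ^-1 ^+ _) (t ^+ _) => u v Du.
  transitivity ((D * u - 1) * (q`_d.+2 * v)); first by ring.
  by rewrite Du subrr mul0r.
have pM t : `|t| <= 1 -> `|p.[t]| <= (D + 1) * M.
  move=> t1; rewrite pE; apply: (le_trans (ler_normB _ _)).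
  rewrite normrM (ger0_norm D0) mulrDl mul1r; apply: lerD; last exact: qM.
  apply: ler_wpM2l => //; apply: qM; rewrite normrM ger0_norm ?invr_ge0 //.
  by have := normr_ge0 t; lra.
have := IH p _ (size_poly _ _) pM.
rewrite coef_poly /= expr1 mulrA; apply: le_trans.
have D1 : 1 <= D / 2 - 1.
  rewrite /D exprS mulrC mulKf ?pnatr_eq0 //.
  have : 1 <= 2 ^+ d :> R by rewrite exprn_ege1 // (ler_nat _ 1 2).
  by rewrite exprS; lra.
by rewrite normrM ler_peMl ?normr_ge0 // ger0_norm //; lra.
Qed.

Lemma deriv_prod (R : comNzRingType) (I : eqType) (r : seq I) (p : I -> {poly R}) :
  uniq r ->
  (\prod_(i <- r) p i)^`()
  = \sum_(j <- r) (p j)^`() * \prod_(i <- r | i != j) p i.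
Proof.
elim: r => [|k r IH] /=; first by rewrite !big_nil -polyC1 derivC.
move=> /andP[kr /IH {}IH].
rewrite big_cons derivM IH big_cons big_cons eqxx mulr_sumr /=.
congr (_ + _).
  congr (_ * _); rewrite big_seq [RHS]big_seq_cond; apply: eq_bigl => i.
  by case: eqP => [->|_]; rewrite ?andbT // (negPf kr).
rewrite [LHS]big_seq [RHS]big_seq; apply: eq_bigr => j jr.
rewrite big_cons ifT; first by rewrite mulrCA.
by apply: contraNneq kr => ->.
Qed.

Section Bernstein.
Variables (R : realFieldType) (I : finType).
Implicit Types (c : {set I} -> R) (y a b : I -> R).

(** For y in [-1,1]^I the weights are the law of independent signs with means y_j, and the
    expectation of a monomial factors over its variables. As an identity it holds for every y. *)
Lemma maff_mean_ext c y :
  maff c y = \sum_(x : {ffun I -> bool})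
               (\prod_j ((1 + y j * sgn R x j) / 2)) * maff c (sgn R x).
Proof.
rewrite /maff; under [RHS]eq_bigr => x _ do rewrite mulr_sumr.
rewrite exchange_big /=; apply: eq_bigr => S _.
under [RHS]eq_bigr => x _ do rewrite mulrCA.
rewrite -mulr_sumr; congr (_ * _).
pose F (j : I) (e : bool) : R :=
  (1 + y j * (-1) ^+ e) / 2 * (if j \in S then (-1) ^+ e else 1).
transitivity (\prod_j \sum_(e : bool) F j e).
  rewrite big_mkcond; apply: eq_bigr => j _; rewrite big_bool /F /=.
  by case: ifP => _; rewrite expr1 expr0; field.
rewrite bigA_distr_bigA; apply: eq_bigr => x _.
by rewrite [X in _ * X]big_mkcond -big_split.
Qed.

Lemma maff_le c M y : (forall x : {ffun I -> bool}, `|maff c (sgn R x)| <= M) ->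
  (forall j, `|y j| <= 1) -> `|maff c y| <= M.
Proof.
move=> cM y1; rewrite maff_mean_ext.
pose w (x : {ffun I -> bool}) := \prod_j ((1 + y j * sgn R x j) / 2).
have w0 x : 0 <= w x.
  apply: prodr_ge0 => j _; rewrite mulr_ge0 ?invr_ge0 //.
  have := y1 j; rewrite ler_norml /sgn => /andP[? ?].
  by case: (x j); rewrite ?expr1 ?expr0; lra.
have w1 : \sum_x w x = 1.
  (* The weights sum to 1: this is the extension formula for the constant polynomial 1. *)
  pose e : {set I} -> R := fun S => (S == set0)%:R.
  have eE z : maff e z = 1.
    by rewrite maff_cst /e ?eqxx // => S /negPf ->.
  rewrite -(eE y) maff_mean_ext; apply: eq_bigr => x _.
  by rewrite eE mulr1.
apply: (le_trans (ler_norm_sum _ _ _)).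
apply: (@le_trans _ _ (\sum_x w x * M)); last by rewrite -mulr_suml w1 mul1r.
apply: ler_sum => x _; rewrite normrM (ger0_norm (w0 x)).
by apply: ler_wpM2l.
Qed.

Definition maff_line c a b : {poly R} :=
  \sum_(S : {set I}) c S *: \prod_(j in S) ((a j)%:P + b j *: 'X).

Lemma horner_maff_line c a b t :
  (maff_line c a b).[t] = maff c (fun j => a j + t * b j).
Proof.
rewrite horner_sum; apply: eq_bigr => S _; rewrite hornerZ horner_prod.
by congr (_ * _); apply: eq_bigr => j _; rewrite !hornerE mulrC.
Qed.

Lemma size_maff_line d c a b : (forall S : {set I}, (d < #|S|)%N -> c S = 0) ->
  (size (maff_line c a b) <= d.+1)%N.
Proof.
move=> cd; apply: (leq_trans (size_sum _ _ _)); apply/bigmax_leqP => S _.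
have [Sd|Sd] := ltnP d #|S|; first by rewrite cd // scale0r size_poly0.
apply: (leq_trans (size_scale_leq _ _)).
apply: (leq_trans (size_poly_prod_leq _ _)).
rewrite leq_subLR.
apply: (@leq_trans (\sum_(j in S) 2).+1); last first.
  by rewrite sum_nat_const muln2 -addnn addnS ltnS leq_add2l.
rewrite ltnS; apply: leq_sum => j _.
apply: (leq_trans (size_polyD _ _)); rewrite geq_max.
rewrite (leq_trans (size_polyC_leq1 _)) //=.
by rewrite (leq_trans (size_scale_leq _ _)) // size_polyX.
Qed.

(** The linear coefficient is the derivative at t = 0, that is, the directional derivative at [a]
    along [b]. *)
Lemma coef1_maff_line c a b :
  (maff_line c a b)`_1 = \sum_j b j * maff (cder c j) a.
Proof.
transitivity (maff_line c a b)^`().[0].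
  by rewrite horner_coef0 coef_deriv mulr1n.
rewrite raddf_sum horner_sum /=.
have dS (S : {set I}) : (c S *: \prod_(j in S) ((a j)%:P + b j *: 'X))^`().[0]
   = \sum_(j in S) b j * (c S * \prod_(i in S :\ j) a i).
  rewrite derivZ hornerZ -big_enum deriv_prod ?enum_uniq // horner_sum mulr_sumr.
  rewrite big_enum; apply: eq_bigr => j jS; rewrite hornerM mulrCA; congr (_ * _).
    by rewrite derivD derivC add0r derivZ derivX !hornerE.
  rewrite horner_prod big_enum_cond /=; congr (_ * _).
  apply: eq_big => [i|i _]; first by rewrite in_setD1 andbC.
  by rewrite !hornerE.
under eq_bigr => S _ do rewrite dS big_mkcond.
rewrite exchange_big /=; apply: eq_bigr => j _.
rewrite -big_mkcond /= -mulr_sumr big_setU1_in; congr (_ * _).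
rewrite /maff [RHS](bigID (fun S : {set I} => j \in S)) /= [X in _ = X + _]big1 ?add0r.
  by apply: eq_bigr => S jS; rewrite /cder (negPf jS) setU1K.
by move=> S jS; rewrite /cder jS mul0r.
Qed.

End Bernstein.

(** * The Boolean Bohnenblust-Hille inequality *)

(** The L^2 norm of the discrete derivative in direction [j], i.e. the square root of the influence
    of [j]. *)
Definition l2_infl (R : rcfType) (I : finType) (c : {set I} -> R) (j : I) : R :=
  Num.sqrt (\sum_(S : {set I} | j \in S) c S ^+ 2).

Lemma sum_sqr_cder (R : realFieldType) (I : finType) (c : {set I} -> R) (j : I) :
  \sum_(S : {set I} | j \in S) c S ^+ 2 = \sum_S cder c j S ^+ 2.
Proof.
rewrite big_setU1_in [RHS](bigID (fun S : {set I} => j \in S)) /=.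
rewrite [X in _ = X + _]big1 ?add0r.
  by apply: eq_bigr => S /negPf jS; rewrite /cder jS.
by move=> S jS; rewrite /cder jS expr0n.
Qed.

(** Each term is the L^2 norm of a partial derivative. Passing to L^1 costs 3^d and evaluating at
    x/2 instead of x costs 2^d, whence 6^d. For fixed x, the sum over j of the absolute partial
    derivatives at x/2 is then a directional derivative, bounded by [coef1_bound]. *)
Lemma sum_l2_infl_bounded (R : rcfType) (d : nat) : exists2 L : R, 0 <= L &
  forall (I : finType) (c : {set I} -> R),
    (forall S : {set I}, (d < #|S|)%N -> c S = 0) ->
    (forall x : {ffun I -> bool}, `|maff c (sgn R x)| <= 1) ->
    \sum_j l2_infl c j <= L.
Proof.
have [K K0 HK] := coef1_bound R d.
exists (6 ^+ d * (2 * K)) => [|I c cd c1].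
  by apply: mulr_ge0; [exact: exprn_ge0 | exact: mulr_ge0].
pose h (x : {ffun I -> bool}) (j : I) : R := sgn R x j / 2.
pose D j x := maff (cder c j) (h x).
have sgn1 (x : {ffun I -> bool}) j : `|sgn R x j| = 1.
  by rewrite /sgn; case: (x j); rewrite ?expr1 ?expr0 ?normrN normr1.
have inflD j : l2_infl c j <= 6 ^+ d * mean (fun x => `|D j x|).
  have M0 : 0 <= mean (fun x => `|D j x|) by apply: mean_ge0 => x; exact: normr_ge0.
  have P0 : 0 <= 6 ^+ d :> R by exact: exprn_ge0.
  have PM0 : 0 <= 6 ^+ d * mean (fun x => `|D j x|) by exact: mulr_ge0.
  rewrite /l2_infl -(ger0_norm PM0) -sqrtr_sqr ler_wsqrtr // sum_sqr_cder.
  (* Absorbing 2^(-|S|) into the coefficients turns evaluation at x/2 into evaluation at a vertex,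
     where [l2_le_l1] applies. *)
  pose g (S : {set I}) := cder c j S * 2^-1 ^+ #|S|.
  have gD x : maff g (sgn R x) = D j x.
    apply: eq_bigr => S _; rewrite /g -mulrA; congr (_ * _).
    by rewrite -prodr_const -big_split /=; apply: eq_bigr => i _; rewrite mulrC.
  have gd (S : {set I}) : (d < #|S|)%N -> cder c j S = 0.
    rewrite /cder; case: ifPn => // jS Sd; apply: cd; rewrite cardsU1 jS.
    exact: (leq_trans Sd (leq_addl _ _)).
  have := @l2_le_l1 _ _ d g.
  under eq_mean => x do rewrite gD.
  move=> H; have {}H := H (fun S Sd => eq_trans (congr1 (fun a => a * _) (gd S Sd)) (mul0r _)).
  apply: (@le_trans _ _ (4 ^+ d * \sum_S g S ^+ 2)).
    rewrite mulr_sumr; apply: ler_sum => S _.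
    have [Sd|Sd] := ltnP d #|S|; first by rewrite /g gd // mul0r expr0n mulr0.
    rewrite /g exprMn mulrCA ler_peMr ?sqr_ge0 //.
    rewrite -exprM mulnC exprM expr2 -invfM -natrM exprVn ler_pdivlMr ?exprn_gt0 //.
    by rewrite mul1r ler_weXn2l // (ler_nat _ 1 4).
  have -> : (6 ^+ d * mean (fun x => `|D j x|)) ^+ 2
      = 4 ^+ d * (9 ^+ d * mean (fun x => `|D j x|) ^+ 2).
    rewrite exprMn -exprM mulnC exprM mulrA -exprMn; congr (_ ^+ d * _); ring.
  by apply: ler_wpM2l => //; exact: exprn_ge0.
apply: (le_trans (ler_sum _ (fun j _ => inflD j))).
rewrite -mulr_sumr; apply: ler_wpM2l; first exact: exprn_ge0.
rewrite -mean_sum -[leRHS](mean_cst I); apply: ler_mean => x.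
(* The signs make all terms of the directional derivative nonnegative; the factor 1/2 keeps x/2 + t
   b in [-1,1]^I for |t| <= 1. *)
pose b j := Num.sg (D j x) / 2.
have := HK (maff_line c (h x) b) 1 (size_maff_line _ _ cd).
rewrite coef1_maff_line mulr1.
have -> : \sum_j b j * maff (cder c j) (h x) = (\sum_j `|D j x|) / 2.
  rewrite mulr_suml; apply: eq_bigr => j _.
  by rewrite [in RHS]normrEsg mulrAC.
rewrite ger0_norm; last by apply: mulr_ge0; [exact: sumr_ge0 | rewrite invr_ge0].
move=> H; suff : (\sum_j `|D j x|) / 2 <= K by lra.
apply: H => t t1; rewrite horner_maff_line; apply: maff_le => // j.
have hj : `|h x j| = 2^-1 by rewrite normrM sgn1 mul1r ger0_norm ?invr_ge0.
have bj : `|b j| <= 2^-1.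
  rewrite /b normrM [X in _ * X]ger0_norm ?invr_ge0 // ler_piMl ?invr_ge0 //.
  by rewrite normr_sg; case: eqP.
apply: (le_trans (ler_normD _ _)); rewrite hj normrM.
have : `|t| * `|b j| <= 1 * 2^-1 by apply: ler_pM.
by lra.
Qed.

Section RealBH.
Variable R : realType.

(** With [X = a ^+ 2 / s] and [Y = s ^+ d], a^(2d) = X^d Y, which is at most (X + Y)^(d+1). *)
Lemma powR_le_sqr_div_add (d : nat) (a s : R) : (0 < d)%N -> 0 <= a -> 0 < s ->
  a `^ ((2 * d)%:R / d.+1%:R) <= a ^+ 2 / s + s ^+ d.
Proof.
move=> d0 a0 s0; set X := a ^+ 2 / s; set Y := s ^+ d.
have X0 : 0 <= X by rewrite divr_ge0 ?sqr_ge0 ?ltW.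
have Y0 : 0 <= Y by rewrite exprn_ge0 ?ltW.
have H : a ^+ (2 * d) <= (X + Y) ^+ d.+1.
  have -> : a ^+ (2 * d) = X ^+ d * Y.
    by rewrite /X /Y expr_div_n -exprM divfK // expf_neq0 ?gt_eqF.
  rewrite exprSr; apply: ler_pM => //; rewrite ?exprn_ge0 ?lerDr //.
  by rewrite lerXn2r ?nnegrE ?addr_ge0 ?lerDl.
rewrite powRrM powR_mulrn //.
apply: (@le_trans _ _ (((X + Y) ^+ d.+1) `^ d.+1%:R^-1)).
  by apply: ge0_ler_powR; rewrite ?invr_ge0 ?nnegrE ?exprn_ge0 ?addr_ge0.
by rewrite -powR_mulrn ?addr_ge0 // -powRrM divff ?pnatr_eq0 // powRr1 ?addr_ge0.
Qed.

Lemma real_bh_bounded (d : nat) : (0 < d)%N -> exists2 K : R, 0 <= K &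
  forall (I : finType) (c : {set I} -> R),
    (forall S : {set I}, (d < #|S|)%N -> c S = 0) ->
    (forall x : {ffun I -> bool}, `|maff c (sgn R x)| <= 1) ->
    \sum_S `|c S| `^ ((2 * d)%:R / d.+1%:R) <= K.
Proof.
move=> d0; have [L L0 HL] := sum_l2_infl_bounded R d.
exists (L + expR L) => [|I c cd c1]; first by rewrite addr_ge0 ?expR_ge0.
have {}HL := HL I c cd c1; set p : R := _ / _.
have p0 : p != 0 by rewrite mulf_neq0 ?invr_eq0 ?pnatr_eq0 // muln_eq0 -lt0n d0.
set s := l2_infl c in HL.
have s0 j : 0 <= s j by exact: sqrtr_ge0.
have sumc1 : \sum_S c S ^+ 2 <= 1.
  rewrite -parseval -(mean_cst I 1); apply: ler_mean => x.
  by rewrite -real_normK ?num_real // expr_le1.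
have s2 j : s j ^+ 2 = \sum_(S : {set I} | j \in S) c S ^+ 2.
  by rewrite sqr_sqrtr // sumr_ge0 // => S _; exact: sqr_ge0.
have s1 j : s j <= 1.
  rewrite -(@expr_le1 _ 2) // s2; apply: le_trans sumc1.
  by rewrite [leRHS](bigID (fun S : {set I} => j \in S)) lerDl sumr_ge0 // => S _; exact: sqr_ge0.
have cs (S : {set I}) j : j \in S -> c S ^+ 2 <= s j ^+ 2.
  by move=> jS; rewrite s2 (bigD1 S) //= lerDl sumr_ge0 // => T _; exact: sqr_ge0.
have pt (S : {set I}) : `|c S| `^ p <= \sum_(j in S) c S ^+ 2 / s j + \prod_(j in S) s j.
  have [Sd|Sd] := ltnP d #|S|.
    rewrite cd // normr0 powR0 // addr_ge0 ?sumr_ge0 ?prodr_ge0 // => j _.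
    by rewrite expr0n mul0r.
  (* For the empty set the product is 1, and Parseval bounds the coefficient by 1. *)
  have [->|/set0Pn[k kS]] := eqVneq S set0.
    rewrite !big_set0 add0r -[leRHS](_ : 1 `^ p = 1); last by rewrite powR1.
    apply: ge0_ler_powR.
    - by rewrite divr_ge0.
    - by rewrite nnegrE.
    - by rewrite nnegrE.
    rewrite -(@expr_le1 _ 2) // real_normK ?num_real //; apply: le_trans sumc1.
    by rewrite [leRHS](bigD1 set0) //= lerDl sumr_ge0 // => T _; exact: sqr_ge0.
  case: (@arg_minP _ _ _ k (mem S) s kS) => j jS jmin.
  (* A zero influence forces [c S = 0], so the quotient by [s j] is only used when it is
     meaningful. *)
  have [sj0|sj0] := eqVneq (s j) 0.
    have -> : c S = 0.
      by apply/eqP; rewrite -sqrf_eq0 eq_le sqr_ge0 (le_trans (cs _ _ jS)) // sj0 expr0n.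
    rewrite normr0 powR0 // addr_ge0 ?sumr_ge0 ?prodr_ge0 // => i _.
    by rewrite expr0n mul0r.
  have sjp : 0 < s j by rewrite lt_neqAle eq_sym sj0 s0.
  apply: (le_trans (powR_le_sqr_div_add d0 (normr_ge0 _) sjp)).
  rewrite real_normK ?num_real //; apply: lerD.
    by rewrite (bigD1 j) //= lerDl sumr_ge0 // => i _; rewrite divr_ge0 ?sqr_ge0.
  (* Lowering the exponent from d to |S| is allowed since [s j <= 1]; minimality of [s j] then gives
     the product. *)
  apply: (@le_trans _ _ (s j ^+ #|S|)); first by rewrite ler_wiXn2l.
  by rewrite -prodr_const; apply: ler_prod => i iS; rewrite s0 jmin.
apply: (le_trans (ler_sum _ (fun S _ => pt S))); rewrite big_split /=.
apply: lerD.
  under eq_bigr => S _ do rewrite big_mkcond.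
  rewrite exchange_big /=; apply: le_trans HL; apply: ler_sum => j _.
  rewrite -big_mkcond /= -mulr_suml -s2.
  have [->|sj0] := eqVneq (s j) 0; first by rewrite expr0n mul0r.
  by rewrite expr2 mulfK.
(* Expanding the product over j of 1 + s_j gives this sum, and 1 + s_j <= exp(s_j) bounds it by
   exp(L). *)
have -> : \sum_(S : {set I}) \prod_(j in S) s j = \prod_j (s j + 1).
  by rewrite bigA_distr; apply: eq_bigr => S _; rewrite big_mkcond.
apply: (@le_trans _ _ (\prod_j expR (s j))).
  by apply: ler_prod => j _; rewrite addr_ge0 //= addrC expR_ge1Dx.
by rewrite -expR_sum ler_expR.
Qed.

End RealBH.

(** * Complex coefficients and the best constant *)

Section ComplexBH.
Variable R : realType.
Local Notation C := R[i].
Implicit Types (z w : C) (d m : nat).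

Lemma cabsE z : cabs z = Num.sqrt (complex.Re z ^+ 2 + complex.Im z ^+ 2).
Proof. by case: z. Qed.

Lemma cabs_ge0 z : 0 <= cabs z.
Proof. by rewrite cabsE sqrtr_ge0. Qed.

Lemma cabs0 : cabs (0 : C) = 0.
Proof. exact: Normc.normc0. Qed.

Lemma cabs1 : cabs (1 : C) = 1.
Proof. exact: Normc.normc1. Qed.

Lemma cabsM z w : cabs (z * w) = cabs z * cabs w.
Proof. exact: Normc.normcM. Qed.

Lemma cabs_real (a : R) : cabs (a%:C)%C = `|a|.
Proof. by rewrite cabsE /= expr0n addr0 sqrtr_sqr. Qed.

Lemma cabs_sum_le (J : finType) (F : J -> C) : cabs (\sum_j F j) <= \sum_j cabs (F j).
Proof.
elim/big_ind2: _ => [|x1 x2 y1 y2 h1 h2|//]; first by rewrite cabs0.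
by apply: (le_trans (le_normcD _ _)); exact: lerD.
Qed.

Lemma cabs_ge_Re z : `|complex.Re z| <= cabs z.
Proof. by rewrite cabsE -sqrtr_sqr ler_wsqrtr // lerDl sqr_ge0. Qed.

Lemma cabs_ge_Im z : `|complex.Im z| <= cabs z.
Proof. by rewrite cabsE -sqrtr_sqr ler_wsqrtr // lerDr sqr_ge0. Qed.

Lemma cabs_le_ReIm z : cabs z <= `|complex.Re z| + `|complex.Im z|.
Proof.
rewrite cabsE -[leRHS]ger0_norm ?addr_ge0 // -sqrtr_sqr ler_wsqrtr //.
rewrite sqrrD !real_normK ?num_real // addrAC lerDl mulrn_wge0 //.
by rewrite mulr_ge0.
Qed.

Lemma Re_sum (J : finType) (F : J -> C) :
  complex.Re (\sum_j F j) = \sum_j complex.Re (F j).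
Proof. by apply: (big_morph (@complex.Re R)) => [[? ?] [? ?]|]. Qed.

Lemma Im_sum (J : finType) (F : J -> C) :
  complex.Im (\sum_j F j) = \sum_j complex.Im (F j).
Proof. by apply: (big_morph (@complex.Im R)) => [[? ?] [? ?]|]. Qed.

Lemma chiE m (S : {set 'I_m}) x : chi R S x = ((\prod_(j in S) sgn R x j)%:C)%C.
Proof.
rewrite /chi rmorph_prod; apply: eq_bigr => j _; rewrite /sgn.
by case: (x j); rewrite ?expr1 ?expr0 ?rmorphN rmorph1.
Qed.

Lemma Re_bfun m (fhat : {set 'I_m} -> C) x :
  complex.Re (bfun fhat x) = maff (fun S => complex.Re (fhat S)) (sgn R x).
Proof.
rewrite Re_sum; apply: eq_bigr => S _; rewrite chiE.
by case: (fhat S) => a b; rewrite /= mulr0 subr0.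
Qed.

Lemma Im_bfun m (fhat : {set 'I_m} -> C) x :
  complex.Im (bfun fhat x) = maff (fun S => complex.Im (fhat S)) (sgn R x).
Proof.
rewrite Im_sum; apply: eq_bigr => S _; rewrite chiE.
by case: (fhat S) => a b; rewrite /= mulr0 add0r.
Qed.

Lemma cabs_le_supnorm m (f : {ffun 'I_m -> bool} -> C) x : cabs (f x) <= supnorm f.
Proof. exact: (le_bigmax_cond 0 (fun x => cabs (f x))). Qed.

Lemma supnorm_ge0 m (f : {ffun 'I_m -> bool} -> C) : 0 <= supnorm f.
Proof. exact: bigmax_ge_id. Qed.

Lemma bh_lhs_eq0 d (J : finType) (P : pred J) (c : J -> C) : (0 < d)%N ->
  (forall j, c j = 0) -> bh_lhs d P c = 0.
Proof.
move=> d0 c0; rewrite /bh_lhs big1 => [|j _]; rewrite ?c0 ?cabs0 powR0 //.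
  by rewrite mulf_neq0 ?invr_eq0 ?pnatr_eq0 // muln_eq0 -lt0n d0.
by rewrite mulf_neq0 ?invr_eq0 ?pnatr_eq0 // muln_eq0 -lt0n d0.
Qed.

(** By Parseval. This settles the case of zero supremum norm, where normalising is impossible. *)
Lemma maff_eq0 (I : finType) (c : {set I} -> R) :
  (forall x : {ffun I -> bool}, maff c (sgn R x) = 0) -> forall S, c S = 0.
Proof.
move=> c0 S; have := parseval c.
under eq_mean => x do rewrite c0 expr0n.
rewrite mean_cst => /esym/eqP; rewrite psumr_eq0 => [|T _]; last exact: sqr_ge0.
by move=> /allP/(_ S); rewrite mem_index_enum sqrf_eq0 => /(_ isT)/eqP.
Qed.

Lemma powR_sum2_le (p a b : R) : 0 <= p -> 0 <= a -> 0 <= b ->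
  (a + b) `^ p <= 2 `^ p * (a `^ p + b `^ p).
Proof.
move=> p0 a0 b0; wlog ab : a b a0 b0 / a <= b.
  by move=> H; case/orP: (le_total a b) => ?; [|rewrite addrC [X in _ * X]addrC]; exact: H.
apply: (@le_trans _ _ ((2 * b) `^ p)).
  by apply: ge0_ler_powR; rewrite ?nnegrE ?addr_ge0 ?mulr_ge0 //; lra.
by rewrite powRM // ler_wpM2l ?powR_ge0 // lerDr powR_ge0.
Qed.

Lemma BH_admissible_exists d : (0 < d)%N -> exists K : R, BH_admissible d K.
Proof.
move=> d0; have [K0 K00 HK] := real_bh_bounded R d0.
pose p : R := (2 * d)%:R / d.+1%:R; pose q : R := d.+1%:R / (2 * d)%:R.
have d2 : (2 * d)%:R != 0 :> R by rewrite pnatr_eq0 muln_eq0 -lt0n d0.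
have pq : p * q = 1 by rewrite /p /q mulrA divfK ?pnatr_eq0 // divff.
have p0 : 0 <= p by rewrite divr_ge0.
have q0 : 0 <= q by rewrite divr_ge0.
exists ((2 `^ p * (K0 + K0)) `^ q) => m _ fhat fd.
have := supnorm_ge0 (bfun fhat); set M := supnorm _ => M0.
have reM x : `|maff (fun S => complex.Re (fhat S)) (sgn R x)| <= M.
  by rewrite -Re_bfun; apply: (le_trans (cabs_ge_Re _)); exact: cabs_le_supnorm.
have imM x : `|maff (fun S => complex.Im (fhat S)) (sgn R x)| <= M.
  by rewrite -Im_bfun; apply: (le_trans (cabs_ge_Im _)); exact: cabs_le_supnorm.
have [Mz|Mn0] := eqVneq M 0.
  rewrite Mz mulr0 bh_lhs_eq0 // => S.
  apply/eqP; rewrite eq_complex; apply/andP; split; apply/eqP.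
    apply: (@maff_eq0 _ (fun S => complex.Re (fhat S))) => x.
    by apply/eqP; rewrite -normr_le0 -Mz.
  apply: (@maff_eq0 _ (fun S => complex.Im (fhat S))) => x.
  by apply/eqP; rewrite -normr_le0 -Mz.
have Mp : 0 < M by rewrite lt_neqAle eq_sym Mn0.
have scaled (c : {set 'I_m} -> R) : (forall S : {set 'I_m}, (d < #|S|)%N -> c S = 0) ->
    (forall x, `|maff c (sgn R x)| <= M) -> \sum_S `|c S| `^ p <= K0 * M `^ p.
  move=> cd cM; have := HK _ (fun S => c S / M).
  have H1 (S : {set 'I_m}) : (d < #|S|)%N -> c S / M = 0 by move=> /cd ->; rewrite mul0r.
  move=> /(_ H1); have H2 x : `|maff (fun S => c S / M) (sgn R x)| <= 1.
    have -> : maff (fun S => c S / M) (sgn R x) = maff c (sgn R x) / M.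
      by rewrite /maff mulr_suml; apply: eq_bigr => S _; rewrite mulrAC.
    by rewrite normrM normfV (gtr0_norm Mp) ler_pdivrMr // mul1r.
  move=> /(_ H2) /(ler_wpM2r (powR_ge0 M p)); rewrite mulr_suml; apply: le_trans.
  rewrite le_eqVlt; apply/orP; left; apply/eqP; apply: eq_bigr => S _.
  by rewrite -powRM // normrM normfV (gtr0_norm Mp) divfK.
have reS := scaled (fun S => complex.Re (fhat S)) (fun S Sd => congr1 _ (fd S Sd)) reM.
have imS := scaled (fun S => complex.Im (fhat S)) (fun S Sd => congr1 _ (fd S Sd)) imM.
apply: (@le_trans _ _ ((2 `^ p * (K0 + K0) * M `^ p) `^ q)).
  apply: ge0_ler_powR; rewrite ?nnegrE //.
  - by rewrite sumr_ge0 // => S _; exact: powR_ge0.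
  - by rewrite !mulr_ge0 ?powR_ge0 ?addr_ge0.
  apply: (@le_trans _ _ (\sum_S 2 `^ p * (`|complex.Re (fhat S)| `^ p + `|complex.Im (fhat S)| `^ p))).
    rewrite big_mkcond; apply: ler_sum => S _; case: ifP => _; last first.
      by rewrite mulr_ge0 ?addr_ge0 ?powR_ge0.
    apply: le_trans (powR_sum2_le p0 (normr_ge0 _) (normr_ge0 _)).
    by apply: ge0_ler_powR; rewrite ?nnegrE ?addr_ge0 ?cabs_ge0 ?cabs_le_ReIm.
  rewrite -mulr_sumr big_split /= -mulrA ler_wpM2l ?powR_ge0 // mulrDl.
  exact: lerD.
rewrite powRM ?mulr_ge0 ?powR_ge0 ?addr_ge0 // -(powRrM M) pq powRr1 //.
Qed.

(** Tested on the constant function 1 of one variable. It yields the positivity of the final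
    constant. *)
Lemma BH_admissible_ge1 d (K : R) : (0 < d)%N -> BH_admissible d K -> 1 <= K.
Proof.
move=> d0 /(_ 1%N isT (fun S => if S == set0 then 1 else 0)) H.
have {}H : bh_lhs d (fun S : {set 'I_1} => (#|S| <= d)%N)
    (fun S => if S == set0 then 1 else 0) <= K * supnorm (bfun (fun S : {set 'I_1} => if S == set0 then 1 : C else 0)).
  by apply: H => S Sd; rewrite ifN //; apply: contraTneq Sd => ->; rewrite cards0.
have := H; rewrite /bh_lhs (bigD1 set0) ?cards0 //= big1 => [|S /andP[_ S0]]; last first.
  by rewrite (negPf S0) cabs0 powR0 // mulf_neq0 ?invr_eq0 ?pnatr_eq0 // muln_eq0 -lt0n d0.
rewrite eqxx cabs1 !powR1 addr0 powR1.
suff -> : supnorm (bfun (fun S : {set 'I_1} => if S == set0 then 1 : C else 0)) = 1.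
  by rewrite mulr1.
have E x : bfun (fun S : {set 'I_1} => if S == set0 then 1 : C else 0) x = 1.
  rewrite /bfun (bigD1 set0) //= eqxx /chi big_set0 mulr1 big1 ?addr0 //.
  by move=> S /negPf ->; rewrite mul0r.
apply/eqP; rewrite eq_le; apply/andP; split.
  by apply: bigmax_le => // x _; rewrite E cabs1.
by apply: le_trans (cabs_le_supnorm _ [ffun=> false]); rewrite E cabs1.
Qed.

Lemma BH_ge1 d : (0 < d)%N -> 1 <= BH R d.
Proof.
move=> d0; apply: lb_le_inf => [|K /= /(BH_admissible_ge1 d0) //].
by have [K HK] := BH_admissible_exists d0; exists K.
Qed.

(** The infimum is attained: if the supremum norm is positive, the quotient of the two norms is a
    lower bound for all admissible constants; if it is zero, any admissible constant makes the
    left-hand side nonpositive. *)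
Lemma BH_admissible_BH d : (0 < d)%N -> BH_admissible d (BH R d).
Proof.
move=> d0 m m0 fhat fd; have := supnorm_ge0 (bfun fhat).
have [K HK] := BH_admissible_exists d0.
rewrite le_eqVlt => /orP[/eqP M0|M0].
  by have := HK m m0 fhat fd; rewrite -M0 !mulr0.
rewrite -ler_pdivrMr //; apply: lb_le_inf; first by exists K.
by move=> K' /= HK'; rewrite ler_pdivrMr //; exact: HK'.
Qed.

End ComplexBH.

(** * Reduction from Pauli strings to the cube *)

Section OperatorNorm.
Variables (R : realType) (n : nat).
Local Notation C := R[i].
Implicit Types (A : qop R n) (u v : qbasis n -> C).

(** Bilinear rather than sesquilinear: the conjugation is left to the vector supplied as [u]. *)
Definition bform u A v : C := \sum_x u x * opapply A v x.

Lemma vnorm_ge0 v : 0 <= vnorm v.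
Proof. exact: sqrtr_ge0. Qed.

Lemma sqr_vnorm v : vnorm v ^+ 2 = \sum_x cabs (v x) ^+ 2.
Proof. by rewrite sqr_sqrtr // sumr_ge0 // => x _; exact: sqr_ge0. Qed.

Lemma cabs_dot_le u v : cabs (\sum_x u x * v x) <= vnorm u * vnorm v.
Proof.
apply: (le_trans (cabs_sum_le _)).
under eq_bigr => x _ do rewrite cabsM.
rewrite -(@ler_pXn2r _ 2) ?nnegrE ?mulr_ge0 ?vnorm_ge0 //; last first.
  by apply: sumr_ge0 => x _; rewrite mulr_ge0 ?cabs_ge0.
by rewrite exprMn !sqr_vnorm; exact: sqr_sum_le.
Qed.

Lemma opnorm_ub A v : vnorm v <= 1 -> vnorm (opapply A v) <= opnorm A.
Proof.
move=> v1; apply: ub_le_sup; last by exists v.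
(* The Frobenius norm bounds the set, so [sup] is a true supremum. *)
exists (Num.sqrt (\sum_x vnorm (A x) ^+ 2)) => _ [w /= w1 <-].
rewrite /vnorm ler_wsqrtr //; apply: ler_sum => x _.
rewrite ler_pXn2r ?nnegrE ?cabs_ge0 ?vnorm_ge0 //.
apply: (le_trans (cabs_dot_le _ _)).
by rewrite ler_piMr ?vnorm_ge0.
Qed.

Lemma cabs_bform_le u A v : vnorm u = 1 -> vnorm v = 1 -> cabs (bform u A v) <= opnorm A.
Proof.
move=> u1 v1; apply: (le_trans (cabs_dot_le _ _)).
by rewrite u1 mul1r opnorm_ub // v1.
Qed.

Lemma bform_pauli_sum u v (Ahat : {ffun 'I_n -> 'I_4} -> C) :
  bform u (pauli_sum Ahat) v = \sum_s Ahat s * bform u (pauli R s) v.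
Proof.
rewrite /bform /opapply.
under [RHS]eq_bigr => s _ do rewrite mulr_sumr.
rewrite exchange_big /=; apply: eq_bigr => x _.
under [RHS]eq_bigr => s _ do rewrite mulrCA mulr_sumr.
rewrite -mulr_sumr; congr (_ * _); rewrite exchange_big /=.
apply: eq_bigr => y _; rewrite mulr_suml.
by apply: eq_bigr => s _; rewrite mulrA.
Qed.

(** The tensor product of the one-site vectors [e j]. *)
Definition pvec (e : 'I_n -> 'I_2 -> C) : qbasis n -> C := fun x => \prod_j e j (x j).

Lemma vnorm_pvec (e : 'I_n -> 'I_2 -> C) :
  (forall j, \sum_p cabs (e j p) ^+ 2 = 1) -> vnorm (pvec e) = 1.
Proof.
move=> e1; rewrite /vnorm -[RHS]sqrtr1; congr Num.sqrt.
transitivity (\prod_j \sum_p cabs (e j p) ^+ 2); last first.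
  by apply: big1 => j _; exact: e1.
rewrite bigA_distr_bigA; apply: eq_bigr => x _.
by rewrite /pvec (big_morph _ (@cabsM R) (@cabs1 R)) prodrXl.
Qed.

(** Vectors and operator are all tensor products, so the double sum over bit strings factors over
    the sites. *)
Lemma bform_pauli (e f : 'I_n -> 'I_2 -> C) s :
  bform (pvec e) (pauli R s) (pvec f)
  = \prod_j \sum_p \sum_q e j p * (pauli1 R (s j) p q * f j q).
Proof.
rewrite bigA_distr_bigA /bform /opapply; apply: eq_bigr => x _.
rewrite mulr_sumr bigA_distr_bigA; apply: eq_bigr => y _.
by rewrite /pvec /pauli -!big_split.
Qed.

End OperatorNorm.

Section PauliEigenvectors.
Variable R : realType.
Local Notation C := R[i].

(* Unit eigenvector of sigma_(k+1) for the eigenvalue (-1)^e. *)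
Definition pauli_eig (k : 'I_3) (e : bool) (p : 'I_2) : C :=
  let h := Num.sqrt (2^-1) in
  match val k, val p with
  | 0%N, 0%N | 1%N, 0%N => (h +i* 0)%C
  | 0%N, _ => ((-1) ^+ e * h +i* 0)%C
  | 1%N, _ => (0 +i* ((-1) ^+ e * h))%C
  | _, 0%N => ((~~ e)%:R +i* 0)%C
  | _, _ => (e%:R +i* 0)%C
  end.

Lemma sqr_sqrt_half : Num.sqrt (2^-1) ^+ 2 = 2^-1 :> R.
Proof. by rewrite sqr_sqrtr // invr_ge0. Qed.

Lemma pauli_eig_unit k e : \sum_p cabs (pauli_eig k e p) ^+ 2 = 1.
Proof.
have H := sqr_sqrt_half.
have cabs2 (z : C) : cabs z ^+ 2 = complex.Re z ^+ 2 + complex.Im z ^+ 2.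
  by rewrite cabsE sqr_sqrtr // addr_ge0 ?sqr_ge0.
rewrite !big_ord_recl big_ord0 !cabs2 /pauli_eig.
by case: k => [[|[|[|]]] //] ?; case: e => /=;
  rewrite ?expr0 ?expr1 ?mulN1r ?mul1r ?sqrrN ?H ?expr0n ?expr1n /= ?addr0 ?add0r; lra.
Qed.

Lemma conj_pauli_eig_unit k e : \sum_p cabs (pauli_eig k e p)^*%C ^+ 2 = 1.
Proof.
rewrite -[RHS](pauli_eig_unit k e); apply: eq_bigr => p _.
by rewrite !cabsE; case: (pauli_eig k e p) => a b /=; rewrite sqrrN.
Qed.

(** The zero reflects that distinct non-identity Pauli matrices anticommute; the proof computes all
    24 cases. *)
Lemma pauli_eig_expect k e (a : 'I_4) :
  \sum_p \sum_q (pauli_eig k e p)^*%C * (pauli1 R a p q * pauli_eig k e q)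
  = if a == ord0 then 1 else if a == lift ord0 k then (if e then -1 else 1) else 0.
Proof.
have H := sqr_sqrt_half.
rewrite !big_ord_recl !big_ord0 /pauli_eig /pauli1.
case: k => [[|[|[|]]] //] ?; case: a => [[|[|[|[|]]]] //] ?; case: e => /=;
  apply/eqP; rewrite eq_complex /=; apply/andP; split; apply/eqP;
  rewrite ?expr0 ?expr1; nra.
Qed.

End PauliEigenvectors.

(** * The function on the cube attached to an operator *)

Section Reduction.
Variables (R : realType) (n : nat).
Local Notation C := R[i].
Local Notation strings := {ffun 'I_n -> 'I_4}.
Local Notation m := #|{: 'I_n * 'I_4}|.
Implicit Types (s t : strings) (x : {ffun 'I_m -> bool}).

(* The sign variable x_(j, k) stands for the eigenvalue of sigma_k at site j;
   the variables with k = 0 never occur. *)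
Definition pauli_support s : {set 'I_m} :=
  [set enum_rank (j, s j) | j in [set j | s j != ord0]].

Lemma pauli_support_rank_inj s : injective (fun j => enum_rank (j, s j)).
Proof. by move=> i j /enum_rank_inj[]. Qed.

Lemma card_pauli_support s : #|pauli_support s| = pweight s.
Proof.
rewrite card_imset; last exact: pauli_support_rank_inj.
(* [pweight] is the cardinal of a classical set. *)
by apply: eq_card => j; rewrite inE; apply/idP/idP => [sj|]; [apply/mem_set|move/set_mem].
Qed.

Lemma mem_pauli_support s j a :
  (enum_rank (j, a) \in pauli_support s) = (a != ord0) && (s j == a).
Proof.
apply/imsetP/andP => [[i si /enum_rank_inj[-> ->]]|[a0 /eqP sja]].
  by rewrite inE in si.
by exists j; rewrite ?inE sja.
Qed.

(** Distinct Pauli coefficients thus become distinct Walsh coefficients, with no cancellation. *)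
Lemma pauli_support_inj : injective pauli_support.
Proof.
move=> s t st; apply/ffunP => j.
have H a : (a != ord0) && (s j == a) = (a != ord0) && (t j == a).
  by rewrite -!mem_pauli_support st.
have := H (s j); have := H (t j); rewrite !eqxx !andbT.
have [-> _|_] := eqVneq (t j) ord0; last by move=> /eqP.
by have [//|s0] := eqVneq (s j) ord0 => /esym /eqP.
Qed.

Variable Ahat : strings -> C.

(** The sum has at most one term, and is 0 when [T] is not the support of a string. The factor
    3^(-|s|) is the probability that a uniform choice of one non-identity Pauli matrix per site
    agrees with s on its support. *)
Definition shadow_coef (T : {set 'I_m}) : C :=
  \sum_(s | pauli_support s == T) 3^-1 ^+ pweight s * Ahat s.

Lemma shadow_coef_support s :
  shadow_coef (pauli_support s) = 3^-1 ^+ pweight s * Ahat s.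
Proof.
rewrite /shadow_coef (big_pred1 s) // => t.
by rewrite /= (inj_eq pauli_support_inj).
Qed.

Lemma shadow_coef_eq0 d (T : {set 'I_m}) :
  (forall s, (d < pweight s)%N -> Ahat s = 0) -> (d < #|T|)%N -> shadow_coef T = 0.
Proof.
move=> Ad Td; apply: big1 => s /eqP sT.
by rewrite Ad ?mulr0 // -card_pauli_support sT.
Qed.

Lemma bfun_shadow x :
  bfun shadow_coef x
  = \sum_s Ahat s * \prod_j (if s j == ord0 then 1
                             else 3^-1 * (if x (enum_rank (j, s j)) then -1 else 1)).
Proof.
rewrite /bfun [RHS](partition_big pauli_support xpredT) //=.
apply: eq_bigr => T _; rewrite /shadow_coef mulr_suml.
apply: eq_bigr => s /eqP <-; rewrite [_ * Ahat s]mulrC -mulrA; congr (_ * _).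
rewrite -card_pauli_support /chi -prodr_const -big_split /=.
rewrite big_imset /=; last by move=> i j _ _; exact: pauli_support_rank_inj.
rewrite big_mkcond; apply: eq_bigr => j _.
by rewrite inE; case: eqP.
Qed.

Definition eig_state (k : {ffun 'I_n -> 'I_3}) x (j : 'I_n) : 'I_2 -> C :=
  pauli_eig R (k j) (x (enum_rank (j, lift ord0 (k j)))).

(** For fixed s the sum over k factors over the sites: a site with s_j = 0 gives 3, any other site
    gives the single sign x_(j,s_j), which is 3 times its factor in [bfun_shadow]. *)
Lemma bfun_shadow_mean x :
  3 ^+ n * bfun shadow_coef x
  = \sum_(k : {ffun 'I_n -> 'I_3})
      bform (pvec (fun j p => (eig_state k x j p)^*%C)) (pauli_sum Ahat)
            (pvec (eig_state k x)).
Proof.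
under [RHS]eq_bigr => k _ do rewrite bform_pauli_sum.
rewrite exchange_big bfun_shadow mulr_sumr /=; apply: eq_bigr => s _.
rewrite -mulr_sumr mulrCA; congr (_ * _).
under [RHS]eq_bigr => k _ do rewrite bform_pauli.
pose F (j : 'I_n) (k : 'I_3) : C :=
  let e := x (enum_rank (j, lift ord0 k)) in
  if s j == ord0 then 1 else if s j == lift ord0 k then (if e then -1 else 1) else 0.
transitivity (\prod_j \sum_k F j k); last first.
  rewrite bigA_distr_bigA; apply: eq_bigr => k _; apply: eq_bigr => j _.
  by rewrite pauli_eig_expect.
have -> : 3 ^+ n = \prod_(j < n) 3 :> C by rewrite prodr_const card_ord.
rewrite -big_split /=; apply: eq_bigr => j _; rewrite /F.
have [sj|sj0] := eqVneq (s j) ord0; first by rewrite sumr_const card_ord mulr1.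
have [k sj|sj] := unliftP ord0 (s j); last by rewrite sj eqxx in sj0.
rewrite mulrA divff ?pnatr_eq0 // mul1r (bigD1 k) //= sj eqxx big1 ?addr0 //.
move=> i ik; rewrite ifN //; apply: contra ik => /eqP/lift_inj ->.
exact: eqxx.
Qed.

Lemma supnorm_shadow_le : supnorm (bfun shadow_coef) <= opnorm (pauli_sum Ahat).
Proof.
have H x : cabs (bfun shadow_coef x) <= opnorm (pauli_sum Ahat).
  have P3 : 0 < 3 ^+ n :> R by rewrite exprn_gt0.
  rewrite -(ler_pM2l P3).
  have -> : 3 ^+ n * cabs (bfun shadow_coef x) = cabs (3 ^+ n * bfun shadow_coef x).
    rewrite cabsM; congr (_ * _).
    have -> : 3 ^+ n = ((3 ^+ n)%:C)%C :> C by rewrite rmorphXn rmorph_nat.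
    by rewrite cabs_real ger0_norm // ltW.
  rewrite bfun_shadow_mean; apply: (le_trans (cabs_sum_le _)).
  apply: (@le_trans _ _ (\sum_(k : {ffun 'I_n -> 'I_3}) opnorm (pauli_sum Ahat))).
    apply: ler_sum => k _; apply: cabs_bform_le; apply: vnorm_pvec => j.
      exact: conj_pauli_eig_unit.
    exact: pauli_eig_unit.
  by rewrite sumr_const card_ffun !card_ord -[_ *+ (3 ^ n)]mulr_natl natrX.
(* The maximum has default value 0, so the norm must be shown nonnegative; the bound at one point
   gives this. *)
apply: bigmax_le => [|x _]; last exact: H.
exact: (le_trans (cabs_ge0 _) (H [ffun=> false])).
Qed.

(** Undoing the factor 3^(-|s|) costs at most 3^d for |s| <= d, and [pauli_support] preserves
    weights. *)
Lemma bh_lhs_le_shadow d : (0 < d)%N ->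
  bh_lhs d (fun s => (pweight s <= d)%N) Ahat
    <= 3 ^+ d * bh_lhs d (fun T : {set 'I_m} => (#|T| <= d)%N) shadow_coef.
Proof.
move=> d0; rewrite /bh_lhs; set p : R := _ / d.+1%:R; set q : R := d.+1%:R / _.
have d2 : (2 * d)%:R != 0 :> R by rewrite pnatr_eq0 muln_eq0 -lt0n d0.
have pq : p * q = 1 by rewrite /p /q mulrA divfK ?pnatr_eq0 // divff.
have p0 : 0 <= p by rewrite divr_ge0.
have q0 : 0 <= q by rewrite divr_ge0.
have P0 : 0 <= 3 ^+ d :> R by rewrite exprn_ge0.
set U := \sum_(T : {set 'I_m} | _) _.
have U0 : 0 <= U by apply: sumr_ge0 => T _; exact: powR_ge0.
have -> : 3 ^+ d * U `^ q = ((3 ^+ d) `^ p * U) `^ q.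
  by rewrite powRM ?powR_ge0 // -powRrM pq powRr1.
apply: ge0_ler_powR; [exact: q0| | |].
- by rewrite nnegrE; apply: sumr_ge0 => s _; exact: powR_ge0.
- by rewrite nnegrE; apply: mulr_ge0; first exact: powR_ge0.
pose g (T : {set 'I_m}) := cabs (shadow_coef T) `^ p.
apply: (@le_trans _ _ (\sum_(s | (pweight s <= d)%N) (3 ^+ d) `^ p * g (pauli_support s))).
  apply: ler_sum => s sd; rewrite /g -powRM ?cabs_ge0 //.
  apply: ge0_ler_powR; [exact: p0 | | | ].
  - by rewrite nnegrE cabs_ge0.
  - by rewrite nnegrE; apply: mulr_ge0 => //; exact: cabs_ge0.
  rewrite shadow_coef_support cabsM.
  have -> : cabs (3^-1 ^+ pweight s : C) = 3^-1 ^+ pweight s.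
    have -> : 3^-1 ^+ pweight s = ((3^-1 ^+ pweight s)%:C)%C :> C.
      by rewrite rmorphXn fmorphV rmorph_nat.
    by rewrite cabs_real ger0_norm // exprn_ge0 // invr_ge0.
  rewrite mulrA ler_peMl ?cabs_ge0 // exprVn ler_pdivlMr ?exprn_gt0 // mul1r.
  by rewrite ler_weXn2l // (ler_nat _ 1 3).
rewrite -mulr_sumr; apply: ler_wpM2l; first exact: powR_ge0.
(* Reindex along the injection, then enlarge its image to all [T] with at most d elements, the terms
   being nonnegative. *)
have -> : \sum_(s | (pweight s <= d)%N) g (pauli_support s)
    = \sum_(T in [set pauli_support s | s in [set s | (pweight s <= d)%N]]) g T.
  rewrite big_imset /=; last by move=> s t _ _; exact: pauli_support_inj.
  by apply: eq_bigl => s; rewrite inE.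
rewrite [leLHS]big_mkcond [leRHS]big_mkcond /=; apply: ler_sum => T _.
case: imsetP => [[s sd ->]|_]; last by case: ifP => // _; exact: powR_ge0.
by rewrite inE in sd; rewrite card_pauli_support sd.
Qed.

End Reduction.

Unset Implicit Arguments.

Theorem theorem1p2 (R : realType) (d : nat) (hd : (1 <= d)%N) :
  exists Cd : R, 0 < Cd /\ Cd <= 3 ^+ d * BH R d /\
    forall (n : nat), (1 <= n)%N ->
    forall Ahat : {ffun 'I_n -> 'I_4} -> R[i],
      (forall s, (d < pweight s)%N -> Ahat s = 0) ->
      bh_lhs d (fun s : {ffun 'I_n -> 'I_4} => (pweight s <= d)%N) Ahat
        <= Cd * opnorm (pauli_sum Ahat).
Proof.
have BH1 := BH_ge1 R hd; have BH0 : 0 < BH R d by exact: lt_le_trans BH1.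
have P0 : 0 < 3 ^+ d :> R by rewrite exprn_gt0.
exists (3 ^+ d * BH R d); split; [exact: mulr_gt0|split=> // n n1 Ahat Ad].
apply: (le_trans (bh_lhs_le_shadow Ahat hd)).
rewrite -mulrA; apply: ler_wpM2l; first exact: ltW.
(* The cube has 4n variables, and admissibility concerns cubes with at least one. *)
have m1 : (1 <= #|{: 'I_n * 'I_4}|)%N by rewrite card_prod !card_ord muln_gt0 n1.
apply: (le_trans (BH_admissible_BH hd m1 (fun T => shadow_coef_eq0 Ad))).
apply: ler_wpM2l; [exact: ltW | exact: supnorm_shadow_le].
Qed.
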